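(* Let $F':\mathbb{C}^{10}\cong\mathbb{R}^{20}\to\mathbb{R}$ be defined, for $z=(z_1,\dots,z_{10})$ with $z_j=x_j+\sqrt{-1}\,y_j$, by $$\begin{aligned}F'(z)=\Big(\sum_{i=1}^{10}|z_i|^2\Big)^2-8\Big\{&|z_5z_{10}-z_6z_9+z_7z_8|^2+|-z_2z_{10}+z_3z_9-z_4z_8|^2\\&+|z_1z_{10}-z_3z_7+z_4z_6|^2+|-z_1z_9+z_2z_7-z_4z_5|^2+|z_1z_8-z_2z_6+z_3z_5|^2\Big\},\end{aligned}$$ and let $M_-^{14}=\{z\in\mathbb{S}^{19} : F'(z)=-1\}$. Then any real quadratic form $Q$ on $\mathbb{R}^{20}$ vanishing on $M_-^{14}$ is identically zero. In particular, $M_-^{14}$ is not quadratic.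
   Context: $F'$, a real quartic form in the 20 real variables $x_j,y_j$, is the isoparametric polynomial with $g=4$, $(m_+,m_-)=(5,4)$; $\mathbb{S}^{19}$ is the unit sphere of $\mathbb{R}^{20}$. A subset of the unit sphere is called quadratic if it is the intersection of the sphere with the common zero set of a family of real quadratic forms. *)

(* Defs.v *)
From HB Require Import structures.
From mathcomp Require Import all_boot all_order all_algebra.
From mathcomp Require Import boolp classical_sets reals.
From mathcomp Require Import complex.

Set Implicit Arguments.
Unset Strict Implicit.
Unset Printing Implicit Defensive.

Import GRing.Theory Num.Theory.

Local Open Scope ring_scope.
Local Open Scope complex_scope.
Local Open Scope classical_set_scope.

Definition unit_sphere (R : realType) (n : nat) : set 'rV[R]_n :=
  [set v | \sum_(i < n) v ord0 i ^+ 2 = 1].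

(* The matrix A is not required to be symmetric: it is not unique, but the
   functions v |-> v A v^T are the same as with A symmetric. *)
Definition is_quadratic_form (R : realType) (n : nat) (Q : 'rV[R]_n -> R) :=
  exists A : 'M[R]_n, forall v, Q v = (v *m A *m v^T) ord0 ord0.

Definition is_quadratic_set (R : realType) (n : nat) (S : set 'rV[R]_n) :=
  exists2 F : set ('rV[R]_n -> R),
    (forall Q, F Q -> is_quadratic_form Q) &
    S = @unit_sphere R n `&` [set v | forall Q, F Q -> Q v = 0].

(* R^(n+n) ~ C^n, (x_1, .., x_n, y_1, .., y_n) |-> (x_j + i y_j)_j *)
Definition complex_row (R : realType) (n : nat) (v : 'rV[R]_(n + n)) :
    'rV[R[i]]_n :=
  \row_(j < n) (lsubmx v ord0 j +i* rsubmx v ord0 j).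

(* |w|^2 as an element of R: the generic norm `|w| lies in R[i]. *)
Definition sqmod (R : realType) (w : R[i]) : R := Normc.normc w ^+ 2.

(* 1-based coordinates: coord1 z j is z_j for 1 <= j <= 10. *)
Definition coord1 (R : realType) (z : 'rV[R[i]]_10) (j : nat) : R[i] :=
  z ord0 (inord j.-1).

Definition Fquartic (R : realType) (z : 'rV[R[i]]_10) : R :=
  let Z := coord1 z in
  (\sum_(i < 10) sqmod (z ord0 i)) ^+ 2
  - 8 * (sqmod (Z 5%N * Z 10%N - Z 6%N * Z 9%N + Z 7%N * Z 8%N)
       + sqmod (- (Z 2%N * Z 10%N) + Z 3%N * Z 9%N - Z 4%N * Z 8%N)
       + sqmod (Z 1%N * Z 10%N - Z 3%N * Z 7%N + Z 4%N * Z 6%N)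
       + sqmod (- (Z 1%N * Z 9%N) + Z 2%N * Z 7%N - Z 4%N * Z 5%N)
       + sqmod (Z 1%N * Z 8%N - Z 2%N * Z 6%N + Z 3%N * Z 5%N)).

Definition Mminus (R : realType) : set 'rV[R]_(10 + 10) :=
  @unit_sphere R (10 + 10) `&` [set v | Fquartic (complex_row v) = -1].
Arguments Mminus : clear implicits.

(* Main.v *)
Require Import Defs.
From mathcomp Require Import all_boot all_order all_algebra.
From mathcomp Require Import boolp classical_sets reals.
From mathcomp Require Import complex.
From mathcomp Require Import ring lra.

(** Identify C^10 with the second exterior power of C^5, the [z_j] being the
    Pluecker coordinates [p_12, p_13, .., p_45]; the five quadrics are, up to a
    factor, the components of [z /\ z]. If [e_l] is one of the 20 real basis
    vectors, lying on the coordinate [p_ab], and [w] is a unit vector in the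
    coordinates [p_cd] with [{c,d}] disjoint from [{a,b}], then
    [(w + e_l) / sqrt 2] and [(- w + e_l) / sqrt 2] lie on [M_-]. Hence, for a
    form [Q] vanishing on [M_-], [w] and [e_l] are [Q]-orthogonal and
    [Q w = - Q e_l]. Two intersecting pairs in [{1,..,5}] have a common disjoint
    pair, so all the off-diagonal coefficients of [Q] vanish and the diagonal
    ones agree on intersecting pairs; they are opposite on disjoint pairs, and
    the Petersen graph is not bipartite, so they vanish as well. *)

Set Implicit Arguments.
Unset Strict Implicit.
Unset Printing Implicit Defensive.

Import Order.TTheory GRing.Theory Num.Theory.
Local Open Scope ring_scope.
Local Open Scope complex_scope.

(** * Combinatorics of disjoint pairs in five letters *)

(* Both real indices [i] and [i + 10] belong to the coordinate [z_(i+1)]. *)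
Definition plucker (i : nat) : seq nat :=
  nth [::] [:: [:: 1; 2]; [:: 1; 3]; [:: 1; 4]; [:: 1; 5]; [:: 2; 3];
               [:: 2; 4]; [:: 2; 5]; [:: 3; 4]; [:: 3; 5]; [:: 4; 5]]%N
      (i %% 10).

Definition disj (i j : nat) : bool := ~~ has (mem (plucker i)) (plucker j).

Lemma ord_iota (n : nat) (i : 'I_n) : (i : nat) \in iota 0 n.
Proof. by rewrite mem_iota add0n ltn_ord. Qed.

Lemma disj_irr (l : 'I_20) : disj l l = false.
Proof.
have /allP H : all (fun i => ~~ disj i i) (iota 0 20) by vm_compute.
by apply/negbTE/H; exact: ord_iota.
Qed.

(** Two meeting or equal pairs cover at most three of the five letters, which leaves room for a
    third pair. *)
Lemma common_disj (i j : 'I_20) :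
  ~~ disj i j -> exists l : 'I_20, disj i l && disj j l.
Proof.
have /allP H : all (fun i => all (fun j => disj i j ||
  has (fun l => disj i l && disj j l) (iota 0 20)) (iota 0 20)) (iota 0 20).
  by vm_compute.
have /allP/(_ _ (@ord_iota 20 j)) := H i (@ord_iota 20 i).
move=> /orP[-> //|/hasP[l]].
by rewrite mem_iota /= => hl dl _; exists (Ordinal hl).
Qed.

(** Joining [m] to [i] and to [l] through common neighbours closes the edge from [i] to [l] into a
    walk of length five in the Petersen graph. *)
Lemma odd_disj (i : 'I_20) :
  exists l m : 'I_20, [&& disj i l, ~~ disj i m & ~~ disj l m].
Proof.
have /allP H : all (fun i => has (fun l => has (fun m =>
  [&& disj i l, ~~ disj i m & ~~ disj l m]) (iota 0 20)) (iota 0 20))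
  (iota 0 20) by vm_compute.
have /hasP[l li /hasP[m mi d]] := H i (@ord_iota 20 i).
move: li mi; rewrite !mem_iota => hl hm.
by exists (Ordinal hl), (Ordinal hm).
Qed.

(** * Values of the quartic and points of M_- *)

Section RealType.
Variable R : realType.

Lemma sqmodE (a b : R) : sqmod (a +i* b) = a ^+ 2 + b ^+ 2.
Proof. by rewrite /sqmod /= sqr_sqrtr // addr_ge0 // sqr_ge0. Qed.

Lemma coord1_row (f : nat -> R) (j : nat) : (0 < j <= 10)%N ->
  coord1 (complex_row (\row_(i < 10 + 10) f i)) j = f j.-1 +i* f (10 + j.-1)%N.
Proof.
by case: j => // j /= hj; rewrite /coord1 !mxE /= inordK.
Qed.

Lemma sum_sqmod (f : nat -> R) :
  \sum_(i < 10) sqmod (complex_row (\row_(i < 10 + 10) f i) ord0 i) =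
  \sum_(i < 10 + 10) f i ^+ 2.
Proof.
rewrite [RHS](@big_split_ord _ _ _ 10 10) /= -big_split /=.
apply: eq_bigr => i _.
by rewrite !mxE sqmodE.
Qed.

(** The three pairs disjoint from that of [l] meet each other, so each quadric reduces to zero or to
    one monomial, the product of the coordinate of [l] with one of those three. *)
Lemma Fquartic_supp (f : nat -> R) (l : 'I_20) :
  (forall i, (i < 20)%N -> i != l -> ~~ disj i l -> f i = 0) ->
  let s := \sum_(i < 10 + 10) f i ^+ 2 in
  Fquartic (complex_row (\row_(i < 10 + 10) f i)) =
  s ^+ 2 - 8 * ((s - f l ^+ 2) * f l ^+ 2).
Proof.
move=> f0 s; rewrite /Fquartic sum_sqmod -/s !coord1_row //=.
simpc; rewrite !sqmodE.
congr (_ - 8 * _); rewrite {}/s !big_ord_recl big_ord0 /=.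
rewrite /bump /= !add1n !addnE /=.
case: l f0 => l /= hl f0.
do 20! (case: l hl f0 => [|l] hl f0;
  (* The indices left are [l] and the six on the three disjoint pairs: 20 - 7 = 13. *)
  [do 13! match goal with
     |- context [f ?k] => rewrite (f0 k isT isT isT)
   end; rewrite /=; ring|]).
by [].
Qed.

Lemma Mminus_mix (l : 'I_(10 + 10)) (w : 'rV[R]_(10 + 10)) :
  (forall i : 'I_(10 + 10), ~~ disj i l -> w ord0 i = 0) ->
  \sum_i w ord0 i ^+ 2 = 1 ->
  Mminus R (Num.sqrt 2^-1 *: (w + delta_mx ord0 l)).
Proof.
move=> w0 w1; set c := Num.sqrt _.
have wl : w ord0 l = 0 by rewrite w0 // disj_irr.
have c2 : c ^+ 2 = 2^-1 by rewrite sqr_sqrtr // invr_ge0.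
set v := _ *: _.
have vE i : v ord0 i = c * (w ord0 i + (i == l)%:R) by rewrite !mxE eqxx.
have v1 : \sum_i v ord0 i ^+ 2 = 1.
  transitivity (\sum_i (2^-1 * w ord0 i ^+ 2 + 2^-1 * (i == l)%:R)).
    apply: eq_bigr => i _; rewrite vE exprMn c2.
    by case: eqVneq => [->|_] /=; rewrite ?wl; field.
  rewrite big_split /= -!mulr_sumr w1 (bigD1 l) //= eqxx big1 ?addr0 /=.
    by field.
  by move=> i /negbTE ->.
split=> //=.
pose f (i : nat) := v ord0 (inord i : 'I_20).
have vf : v = \row_(i < 10 + 10) f i.
  by apply/rowP => i; rewrite [RHS]mxE /f inord_val.
(* Here [s] is 1 and [f l ^+ 2] is 1/2, so the value is 1 - 8 * (1/4) = -1. *)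
rewrite vf (@Fquartic_supp f l); last first.
  move=> i hi il dil; rewrite /f vE w0 ?inordK //.
  by rewrite -val_eqE /= inordK // (negbTE il) addr0 mulr0.
have -> : \sum_(i < 10 + 10) f i ^+ 2 = 1.
  by rewrite -[RHS]v1; apply: eq_bigr => i _; rewrite /f inord_val.
have -> : f l ^+ 2 = 2^-1.
  by rewrite /f inord_val vE wl eqxx exprMn c2 /=; field.
by field.
Qed.

(** * The bilinear form of a matrix *)

Section BilinearForm.
Variables (n : nat) (A : 'M[R]_n).
Implicit Types u v w : 'rV[R]_n.

Definition bform u v : R :=
  (u *m A *m v^T) ord0 ord0.

Lemma bformDl u u' v :
  bform (u + u') v = bform u v + bform u' v.
Proof. by rewrite /bform !mulmxDl mxE. Qed.

Lemma bformDr u v v' :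
  bform u (v + v') = bform u v + bform u v'.
Proof. by rewrite /bform linearD mulmxDr mxE. Qed.

Lemma bformZl a u v : bform (a *: u) v = a * bform u v.
Proof. by rewrite /bform -!scalemxAl mxE. Qed.

Lemma bformZr a u v : bform u (a *: v) = a * bform u v.
Proof. by rewrite /bform linearZ -scalemxAr mxE. Qed.

Lemma bform_delta i j :
  bform (delta_mx ord0 i) (delta_mx ord0 j) = A i j.
Proof. by rewrite /bform trmx_delta -rowE -colE !mxE. Qed.

(** Transposing a 1 by 1 matrix replaces [A] by its transpose, here [- A], so the value is its own
    opposite. *)
Lemma bform_alt :
  (forall i j, A i j + A j i = 0) -> forall v, bform v v = 0.
Proof.
move=> A0 v.
have trE : (v *m A^T *m v^T) ord0 ord0 = bform v v.
  have -> : v *m A^T *m v^T = (v *m A *m v^T)^T.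
    by rewrite !trmx_mul trmxK mulmxA.
  by rewrite mxE.
have AN : A^T = - A.
  by apply/matrixP => i j; rewrite !mxE; apply/eqP; rewrite -addr_eq0 A0.
move: trE; rewrite AN mulmxN mulNmx mxE -/(bform v v); lra.
Qed.

End BilinearForm.

Definition bformE := (bformDl, bformDr, bformZl, bformZr, bform_delta).

(** * Forms vanishing on M_- *)

Section Vanishing.
Variable A : 'M[R]_(10 + 10).
Hypothesis A0 : forall v, Mminus R v -> bform A v v = 0.

Lemma bform_mix (l : 'I_(10 + 10)) (w : 'rV[R]_(10 + 10)) :
  (forall i : 'I_(10 + 10), ~~ disj i l -> w ord0 i = 0) ->
  \sum_i w ord0 i ^+ 2 = 1 ->
  bform A w w + bform A w (delta_mx ord0 l) + bform A (delta_mx ord0 l) w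
    + A l l = 0.
Proof.
move=> w0 w1; have := A0 (Mminus_mix w0 w1).
have : Num.sqrt (2^-1 : R) != 0 by rewrite sqrtr_eq0 -ltNge invr_gt0.
set c := Num.sqrt _ => c0; rewrite bformZl bformZr => /eqP.
rewrite !mulf_eq0 (negbTE c0) /= => /eqP <-; rewrite !bformE; ring.
Qed.

Lemma bform_disj (k l : 'I_(10 + 10)) :
  disj k l -> A k l + A l k = 0 /\ A k k = - A l l.
Proof.
move=> kl.
(* Only the signs [a = 1] and [a = -1] occur; the sum and the difference of the two equations give
   both claims. *)
have E (a : R) : a ^+ 2 = 1 -> A k k + a * (A k l + A l k) + A l l = 0.
  move=> a1; have := @bform_mix l (a *: delta_mx ord0 k).
  rewrite !bformE mulrA -expr2 a1 => <-; first by ring.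
    move=> i il; rewrite !mxE /=; case: eqVneq il => [->|_ _].
      by rewrite kl.
    by rewrite mulr0.
  rewrite (bigD1 k) //= big1 => [|i /negbTE ik].
    by rewrite !mxE !eqxx /= mulr1 addr0.
  by rewrite !mxE ik andbF mulr0 expr0n.
have := E 1 (expr1n _ _); have := E (-1) (etrans (sqrrN _) (expr1n _ _)).
by split; lra.
Qed.

Lemma bform_off (k k' l : 'I_(10 + 10)) :
  k != k' -> disj k l -> disj k' l -> A k k' + A k' k = 0.
Proof.
move=> kk' kl k'l.
(* A unit vector with rational nonzero entries. By [bform_disj] the diagonal terms cancel [A l l]
   and the cross terms with [l] vanish, leaving 12/25 of the sum sought. *)
have := @bform_mix l ((3 / 5) *: delta_mx ord0 k + (4 / 5) *: delta_mx ord0 k').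
have [? ?] := bform_disj kl; have [? ?] := bform_disj k'l.
rewrite !bformE => H; suff : 12 / 25 * (A k k' + A k' k) = 0 by lra.
rewrite -[RHS]H; first by lra.
  move=> i il; rewrite !mxE /=.
  by case: eqVneq il => [->|_]; case: eqVneq => [->|_];
    rewrite ?kl ?k'l ?mulr0 ?addr0.
rewrite (bigD1 k) //= (bigD1 k') 1?eq_sym //= big1 => [|i].
  by rewrite !mxE !eqxx (negbTE kk') eq_sym (negbTE kk') /=; field.
move=> /andP[/negbTE ik /negbTE ik'].
by rewrite !mxE ik ik' !mulr0 addr0 expr0n.
Qed.

Lemma bform_eq0 v : bform A v v = 0.
Proof.
have same (k k' l : 'I_(10 + 10)) : disj k l -> disj k' l -> A k k = A k' k'.
  by move=> /bform_disj[_ ->] /bform_disj[_ ->].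
apply: bform_alt => i j; case: (eqVneq i j) => [<-|ij].
  (* [A i i], [A m m] and [A l l] agree through the common neighbours [p] and [q], whereas
     [A i i = - A l l]. *)
  have [l [m /and3P[/bform_disj[_ il] /common_disj[p /andP[ip mp]]]]] :=
    odd_disj i.
  move=> /common_disj[q /andP[lq mq]].
  have := same _ _ _ ip mp; have := same _ _ _ lq mq; lra.
have [/bform_disj[] //|/common_disj[l /andP[il jl]]] := boolP (disj i j).
exact: bform_off ij il jl.
Qed.

End Vanishing.
End RealType.

Theorem theorem3p5 (R : realType) :
  (forall Q : 'rV[R]_(10 + 10) -> R,
      is_quadratic_form Q ->
      (forall v, Mminus R v -> Q v = 0) ->
      forall v, Q v = 0)
  /\ ~ is_quadratic_set (Mminus R).
Proof.
have vanish (Q : 'rV[R]_(10 + 10) -> R) : is_quadratic_form Q ->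
    (forall v, Mminus R v -> Q v = 0) -> forall v, Q v = 0.
  by move=> [A QA] Q0 v; rewrite QA; apply: bform_eq0 => w /Q0; rewrite QA.
split=> // -[F Fquad MF].
(* If M_- were quadratic, its defining forms would all be zero and it would be the whole sphere; but
   the quartic is 1 at the first basis vector. *)
pose f (i : nat) : R := (i == 0%N)%:R.
have f1 : \sum_(i < 10 + 10) f i ^+ 2 = 1.
  by rewrite big_ord_recl big1 /f ?expr1n ?addr0 // => i _; rewrite expr0n.
have : Mminus R (\row_(i < 10 + 10) f i).
  rewrite MF; split=> [|Q FQ].
    by apply: etrans f1; apply: eq_bigr => i _; rewrite mxE.
  by apply: vanish (Fquad Q FQ) _ _ => v; rewrite MF => -[_]; apply.
move=> [_]; rewrite /= (@Fquartic_supp _ _ ord0).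
  by rewrite f1 /f /= expr1n subrr mul0r mulr0 subr0; lra.
by move=> i _ /negbTE i0; rewrite /f i0.
Qed.
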